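(* Let $\mathcal{A}$ be an Abelian category with an epi-generator and $\mathbf{t}=(\mathcal{T},\mathcal{F})$ a torsion pair in $\mathcal{A}$. The following assertions are equivalent: (1) $\mathbf{t}$ is a tilting torsion pair; (2) $({}^{\perp_1}\mathcal{T},\mathcal{T})$ is a right complete cotorsion pair and ${}^{\perp_1}\mathcal{T}$ contains an epi-generator of $\mathcal{A}$; (3) $({}^{\perp_1}\mathcal{T},\mathcal{T})$ is a complete cotorsion pair in $\mathcal{A}$; (4) $\mathcal{T}$ is special preenveloping in $\mathcal{A}$ and ${}^{\perp_1}\mathcal{T}$ generates $\mathcal{T}$. In particular, the assignment $[V]\mapsto\mathrm{Gen}(V)$ gives a one-to-one correspondence between the equivalence classes of tilting objects in $\mathcal{A}$ and the special preenveloping torsion classes $\mathcal{T}$ in $\mathcal{A}$ such that ${}^{\perp_1}\mathcal{T}$ generates $\mathcal{T}$.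
   Context: All subcategories are full. Abelian categories are not assumed to have all small (co)products; (co)products appearing in definitions are those that exist. $\mathrm{Ext}^1_{\mathcal{A}}$ is the Yoneda (possibly proper class) group of extensions. $\mathcal{X}^{\perp_1}=\{A:\mathrm{Ext}^1_{\mathcal{A}}(X,A)=0\ \forall X\in\mathcal{X}\}$, ${}^{\perp_1}\mathcal{X}=\{A:\mathrm{Ext}^1_{\mathcal{A}}(A,X)=0\ \forall X\in\mathcal{X}\}$, $V^{\perp_1}=\{V\}^{\perp_1}$. An epi-generator of $\mathcal{A}$ is an object $G$ such that every object of $\mathcal{A}$ is a quotient of an existing coproduct of copies of $G$. A torsion pair in $\mathcal{A}$ is a pair $(\mathcal{T},\mathcal{F})$ of subcategories with $\mathcal{F}=\{A:\mathcal{A}(T,A)=0\ \forall T\in\mathcal{T}\}$, $\mathcal{T}=\{A:\mathcal{A}(A,F)=0\ \forall F\in\mathcal{F}\}$ and such that each $A\in\mathcal{A}$ fits in a short exact sequence $0\to T_A\to A\to F_A\to 0$ with $T_A\in\mathcal{T}$, $F_A\in\mathcal{F}$; $\mathcal{T}$ is called a torsion class. $\mathrm{Add}(V)$ is the class of direct summands of (existing) coproducts of copies of $V$; $\mathrm{Gen}(V)$ is the class of quotients of objects of $\mathrm{Add}(V)$; $\mathrm{Pres}(V)$ is the class of cokernels of morphisms in $\mathrm{Add}(V)$; $\overline{\mathrm{Gen}}(V)$ is the class of subobjects of objects of $\mathrm{Gen}(V)$. A torsion pair $(\mathcal{T},\mathcal{F})$ is tilting, and $V$ is a tilting object, if there is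 an object $V$ with $\mathcal{T}=\mathrm{Gen}(V)=\mathrm{Pres}(V)=\overline{\mathrm{Gen}}(V)\cap V^{\perp_1}$ (i.e. $V$ is quasi-tilting) and $\mathcal{T}$ is cogenerating, i.e. every object of $\mathcal{A}$ embeds in an object of $\mathcal{T}$. Two tilting objects $V,V'$ are equivalent if $\mathrm{Add}(V)=\mathrm{Add}(V')$; $[V]$ denotes the equivalence class. A special $\mathcal{T}$-preenvelope of $M$ is a monomorphism $\phi\colon M\to T_M$ with $T_M\in\mathcal{T}$, such that $\mathcal{A}(T_M,T)\to\mathcal{A}(M,T)$ is surjective for all $T\in\mathcal{T}$, and with $\mathrm{Coker}(\phi)\in{}^{\perp_1}\mathcal{T}$. $\mathcal{T}$ is special preenveloping if every object has a special $\mathcal{T}$-preenvelope. ''${}^{\perp_1}\mathcal{T}$ generates $\mathcal{T}$'' means that each object of $\mathcal{T}$ is an epimorphic image of one in ${}^{\perp_1}\mathcal{T}$. A cotorsion pair is a pair $(\mathcal{X},\mathcal{Y})$ with $\mathcal{Y}=\mathcal{X}^{\perp_1}$ and $\mathcal{X}={}^{\perp_1}\mathcal{Y}$; it is right (resp. left) complete if every $A\in\mathcal{A}$ admits a short exact sequence $0\to A\to Y\to X\to 0$ (resp. $0\to Y\to X\to A\to 0$) with $X\in\mathcal{X}$, $Y\in\mathcal{Y}$; it is complete if it is both left and right complete. *)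

(* Defs.v *)
From mathcomp Require Import all_boot all_algebra.
From mathcomp Require Import boolp classical_sets functions.

Set Implicit Arguments.
Unset Strict Implicit.
Unset Printing Implicit Defensive.

Import GRing.Theory.

Declare Scope cat_scope.
Delimit Scope cat_scope with C.
Local Open Scope classical_set_scope.
Local Open Scope ring_scope.
Local Open Scope cat_scope.

Record preadditive := Preadditive {
  obj :> Type;
  mor : obj -> obj -> zmodType;
  idm : forall A, mor A A;
  ccomp : forall A B C, mor B C -> mor A B -> mor A C;
  ccompA : forall A B C D (h : mor C D) (g : mor B C) (f : mor A B),
    ccomp h (ccomp g f) = ccomp (ccomp h g) f;
  comp1m : forall A B (f : mor A B), ccomp (idm B) f = f;
  compm1 : forall A B (f : mor A B), ccomp f (idm A) = f;
  compDl : forall A B C (g g' : mor B C) (f : mor A B),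
    ccomp (g + g') f = ccomp g f + ccomp g' f;
  compDr : forall A B C (g : mor B C) (f f' : mor A B),
    ccomp g (f + f') = ccomp g f + ccomp g f'
}.

Arguments idm {p} A.
Notation "g \oc f" := (ccomp g f) (at level 40, left associativity) : cat_scope.

Section Preadditive.
Variable C : preadditive.

Definition mono (A B : C) (f : mor A B) : Prop :=
  forall (W : C) (g h : mor W A), f \oc g = f \oc h -> g = h.

Definition epi (A B : C) (f : mor A B) : Prop :=
  forall (W : C) (g h : mor B W), g \oc f = h \oc f -> g = h.

Definition is_kernel (K A B : C) (k : mor K A) (f : mor A B) : Prop :=
  f \oc k = 0 /\
  forall (W : C) (g : mor W A), f \oc g = 0 -> exists! h : mor W K, k \oc h = g.

Definition is_cokernel (A B Q : C) (f : mor A B) (q : mor B Q) : Prop :=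
  q \oc f = 0 /\
  forall (W : C) (g : mor B W), g \oc f = 0 -> exists! h : mor Q W, h \oc q = g.

Definition is_zero (Z : C) : Prop :=
  forall W : C, (forall f : mor W Z, f = 0) /\ (forall f : mor Z W, f = 0).

Record is_biproduct (A B S : C) (i : mor A S) (j : mor B S)
    (p : mor S A) (q : mor S B) : Prop := IsBiproduct {
  biprod_pi : p \oc i = idm A;
  biprod_qj : q \oc j = idm B;
  biprod_pj : p \oc j = 0;
  biprod_qi : q \oc i = 0;
  biprod_sum : i \oc p + j \oc q = idm S
}.

Definition is_coproduct (I : Type) (X : I -> C) (S : C)
    (inj : forall i, mor (X i) S) : Prop :=
  forall (W : C) (f : forall i, mor (X i) W),
    exists! h : mor S W, forall i, h \oc inj i = f i.

End Preadditive.

Record is_abelian (C : preadditive) : Prop := IsAbelian {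
  ab_zero : exists Z : C, is_zero Z;
  ab_biprod : forall A B : C, exists (S : C) (i : mor A S) (j : mor B S)
    (p : mor S A) (q : mor S B), is_biproduct i j p q;
  ab_kernel : forall (A B : C) (f : mor A B),
    exists (K : C) (k : mor K A), is_kernel k f;
  ab_cokernel : forall (A B : C) (f : mor A B),
    exists (Q : C) (q : mor B Q), is_cokernel f q;
  ab_mono : forall (A B : C) (f : mor A B), mono f ->
    exists (D : C) (g : mor B D), is_kernel f g;
  ab_epi : forall (A B : C) (f : mor A B), epi f ->
    exists (D : C) (g : mor D A), is_cokernel g f
}.

Record abelianCat := AbelianCat {
  ab_cat :> preadditive;
  ab_axioms : is_abelian ab_cat
}.

Section Abelian.
Variable C : abelianCat.
Implicit Types (A B E M S V W X Y : C) (T F XX YY : set C).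

Definition short_exact A B D (f : mor A B) (g : mor B D) : Prop :=
  is_kernel f g /\ is_cokernel f g.

(* Elements 0 -> A -> E -> X -> 0 of Ext^1(X, A), before identification. *)
Record extension X A := Extension {
  ext_mid : C;
  ext_in : mor A ext_mid;
  ext_out : mor ext_mid X;
  ext_exact : short_exact ext_in ext_out
}.

(* Yoneda equivalence; such an [h] is an isomorphism by the short five lemma. *)
Definition ext_equiv X A (e e' : extension X A) : Prop :=
  exists h : mor (ext_mid e) (ext_mid e'),
    h \oc ext_in e = ext_in e' /\ ext_out e' \oc h = ext_out e.

(* Representatives of the zero of Ext^1(X, A): A -> A (+) X -> X. *)
Definition ext_zero X A (e : extension X A) : Prop :=
  exists (j : mor X (ext_mid e)) (p : mor (ext_mid e) A),
    is_biproduct (ext_in e) j p (ext_out e).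

Definition Ext1_eq0 X A : Prop :=
  forall e : extension X A, exists2 e0, ext_zero e0 & ext_equiv e e0.

Definition rperp1 XX : set C := [set A | forall X, XX X -> Ext1_eq0 X A].

Definition lperp1 XX : set C := [set A | forall X, XX X -> Ext1_eq0 A X].

Definition is_copower (V : C) (I : Type) S : Prop :=
  exists inj : I -> mor V S, is_coproduct (X := fun=> V) inj.

Definition copowers V : set C := [set S | exists I : Type, is_copower V I S].

Definition quotient_of (XX : set C) : set C :=
  [set A | exists (X : C) (f : mor X A), XX X /\ epi f].

Definition subobject_of (XX : set C) : set C :=
  [set A | exists (X : C) (f : mor A X), XX X /\ mono f].

Definition summand_of (XX : set C) : set C :=
  [set A | exists (S B : C) (i : mor A S) (j : mor B S)
             (p : mor S A) (q : mor S B), XX S /\ is_biproduct i j p q].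

Definition epi_generator (G : C) : Prop :=
  forall A, quotient_of (copowers G) A.

Definition Add V : set C := summand_of (copowers V).

Definition Gen V : set C := quotient_of (Add V).

Definition Pres V : set C :=
  [set A | exists (M N : C) (f : mor M N) (g : mor N A),
             [/\ Add V M, Add V N & is_cokernel f g]].

Definition subGen V : set C := subobject_of (Gen V).

Definition torsion_pair T F : Prop :=
  [/\ F = [set A | forall X, T X -> forall f : mor X A, f = 0],
      T = [set A | forall Y, F Y -> forall f : mor A Y, f = 0] &
      forall A, exists (TA FA : C) (f : mor TA A) (g : mor A FA),
        [/\ T TA, F FA & short_exact f g]].

Definition torsion_class T : Prop := exists F, torsion_pair T F.

Definition cogenerating T : Prop := forall A, subobject_of T A.

Definition tilting_via V T : Prop :=
  [/\ T = Gen V, Gen V = Pres V, Pres V = subGen V `&` rperp1 [set V] &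
      cogenerating T].

Definition tilting_torsion_pair T F : Prop :=
  torsion_pair T F /\ exists V, tilting_via V T.

Definition tilting_object V : Prop :=
  exists T F, torsion_pair T F /\ tilting_via V T.

(* The equivalence class [V], as a set of tilting objects. *)
Definition tilting_eqclass V : set C :=
  [set W | tilting_object W /\ Add W = Add V].

Definition tilting_eqclasses : set (set C) :=
  [set c | exists2 V, tilting_object V & c = tilting_eqclass V].

Definition special_preenvelope T M TM (phi : mor M TM) : Prop :=
  [/\ mono phi, T TM,
      forall X, T X -> forall f : mor M X, exists g : mor TM X, g \oc phi = f &
      exists (Q : C) (q : mor TM Q), is_cokernel phi q /\ lperp1 T Q].

Definition special_preenveloping T : Prop :=
  forall M, exists (TM : C) (phi : mor M TM), special_preenvelope T phi.

Definition generates XX T : Prop := T `<=` quotient_of XX.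

Definition cotorsion_pair XX YY : Prop := YY = rperp1 XX /\ XX = lperp1 YY.

Definition right_complete XX YY : Prop :=
  forall A, exists (Y X : C) (f : mor A Y) (g : mor Y X),
    [/\ YY Y, XX X & short_exact f g].

Definition left_complete XX YY : Prop :=
  forall A, exists (Y X : C) (f : mor Y X) (g : mor X A),
    [/\ YY Y, XX X & short_exact f g].

Definition right_complete_cotorsion_pair XX YY : Prop :=
  cotorsion_pair XX YY /\ right_complete XX YY.

Definition complete_cotorsion_pair XX YY : Prop :=
  [/\ cotorsion_pair XX YY, left_complete XX YY & right_complete XX YY].

End Abelian.

(* Main.v *)
(* Coproducts need not exist, but if the copower G^(I) of an epi-generator G
   exists, then so does V^(I) for every V: write V as the cokernel of a map
   G^(J') -> G^(J), so that V^(I) is the cokernel of a map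
   G^(J' * I) -> G^(J * I).  The index types of existing copowers of G are
   closed under products, because K * K injects into K for infinite K.

   If T is special preenveloping and lperp1 T generates T, then lperp1 T
   contains an epi-generator G.  With 0 -> G -> V0 -> V1 -> 0 a special
   preenvelope, V = V0 (+) V1 is tilting: T cogenerates, so the right exact
   sequences G^(I) -> V0^(I) -> V1^(I) are exact, and comparing two special
   preenvelopes by pushouts shows that T /\ lperp1 T = Add V.  This equality
   also makes [V] |-> Gen V injective.  Conversely, for V tilting, pulling back
   presentations by Add V along embeddings into T yields both special
   preenvelopes and an epi-generator in lperp1 T. *)

Require Import Defs.
From mathcomp Require Import all_boot all_algebra.
From mathcomp Require Import boolp classical_sets functions cardinality.

Set Implicit Arguments.
Unset Strict Implicit.
Unset Printing Implicit Defensive.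

Import GRing.Theory.

Local Open Scope classical_set_scope.
(** * Squares of infinite types *)

Definition injects (X Y : Type) : Prop := exists f : X -> Y, injective f.

Lemma injects_trans (X Y Z : Type) : injects X Y -> injects Y Z -> injects X Z.
Proof. by move=> [f fI] [g gI]; exists (g \o f); exact: inj_comp. Qed.

(** By Zorn's lemma there is a maximal partial bijection; two unmatched points, one on each side,
    would enlarge it, so it is total on one side. *)
Lemma injects_total (X Y : Type) : injects X Y \/ injects Y X.
Proof.
pose P := [set R : set (X * Y) | forall p q, R p -> R q -> p.1 = q.1 <-> p.2 = q.2].
have [F FP Ftot|R [PR Rmax]] := @Zorn_bigcup _ P.
  move=> p q [A FA Ap] [B FB Bq].
  have [AB|BA] := Ftot _ _ FA FB; first by apply: (FP _ FB) => //; exact: AB.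
  by apply: (FP _ FA) => //; exact: BA.
have [Rl|/existsNP[x Nx]] := pselect (forall x, exists y, R (x, y)).
  left; have [f Rf] := choice Rl; exists f => x x' fxx'.
  by apply/(PR _ _ (Rf x) (Rf x')).
have [Rr|/existsNP[y Ny]] := pselect (forall y, exists x, R (x, y)).
  right; have [g Rg] := choice Rr; exists g => y y' gyy'.
  by apply/(PR _ _ (Rg y) (Rg y')).
case: (Rmax (R `|` [set (x, y)])).
  split; first by move=> p; left.
  by move=> /(_ (x, y)) RR; apply: Nx; exists y; apply: RR; right.
move=> [a b] [a' b'] /= [Rab|[-> ->]] [Rab'|[-> ->]] //.
- exact: (PR _ _ Rab Rab').
- by split=> E; [case: Nx; exists b; rewrite -E | case: Ny; exists a; rewrite -E].
- by split=> E; [case: Nx; exists b'; rewrite E | case: Ny; exists a'; rewrite E].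
Qed.

Lemma sval_inj T (P : T -> Prop) : injective (@sval T P).
Proof. by move=> [x p] [y q] /= xy; exact: eq_exist. Qed.

Section Square.
Variable K : Type.
Implicit Types R : set (K * K * K).

Let dom R : set K := [set a | exists c, R (a, a, c)].

(* [R] is the graph of an injection [dom R * dom R -> dom R]. *)
Let is_pairing R : Prop :=
  [/\ forall a b c, R (a, b, c) -> [/\ dom R a, dom R b & dom R c],
      forall a b, dom R a -> dom R b -> exists c, R (a, b, c) &
      forall a b c a' b' c', R (a, b, c) -> R (a', b', c') ->
        (a = a' /\ b = b') <-> c = c'].

(** Let [A] be the domain of a maximal pairing and [B] its complement. If [B] injects into [A], then
    so does [K], through two tagged copies of [A] inside [A], and the pairing on [A] gives the
    result. Otherwise [A] injects into [B], and the pairing extends to [A] together with its image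
    in [B], against maximality. *)
Lemma injects_square : injects nat K -> injects (K * K) K.
Proof.
move=> [e eI].
pose R0 : set (K * K * K) :=
  [set t | exists m n, t = (e m, e n, e (pickle (m, n)))].
have dom0 a : dom R0 a <-> exists m, a = e m.
  split=> [[c [m [n [-> _ _]]]]|[m ->]]; first by exists m.
  by exists (e (pickle (m, m))), m, m.
have good0 : is_pairing R0.
  split=> [a b c [m [n [-> -> ->]]]|a b /dom0[m ->] /dom0[n ->]|].
  - by split; apply/dom0; eexists.
  - by exists (e (pickle (m, n))), m, n.
  - move=> a b c a' b' c' [m [n [-> -> ->]]] [m' [n' [-> -> ->]]].
    split=> [[/eI -> /eI ->] //|/eI /(pcan_inj pickleK) [-> ->] //].
pose P := [set R | R = set0 \/ (R0 `<=` R /\ is_pairing R)].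
have [F FP Ftot|R [PR Rmax]] := @Zorn_bigcup _ P.
  have [allE|] := pselect (forall R, F R -> R = set0).
    by left; apply/seteqP; split=> // t [R FR]; rewrite (allE R FR).
  move=> /existsNP[R1 /not_implyP[FR1 R1N]]; right.
  have good R : F R -> R != set0 -> R0 `<=` R /\ is_pairing R.
    by move=> /FP[->|//]; rewrite eqxx.
  have sub R : F R -> R `<=` \bigcup_(S in F) S by move=> FR t Rt; exists R.
  have both t t' : (\bigcup_(S in F) S) t -> (\bigcup_(S in F) S) t' ->
      exists S, [/\ F S, S t & S t'].
    move=> [S FS St] [S' FS' St']; have [SS|SS] := Ftot _ _ FS FS'.
      by exists S'; split=> //; exact: SS.
    by exists S; split=> //; exact: SS.
  have nz (S : set (K * K * K)) t : S t -> S != set0.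
    by move=> St; apply/eqP => E; rewrite E in St.
  have up (S : set (K * K * K)) a : F S -> dom S a -> dom (\bigcup_(S in F) S) a.
    by move=> FS [c Sc]; exists c; exact: (sub S).
  split.
    by move=> t R0t; exists R1 => //; apply: (good R1 FR1 _).1 => //; apply/eqP.
  split=> [a b c [S FS St]|a b [c ac] [d bd]|a b c a' b' c' H H'].
  - have [_ [/(_ _ _ _ St)[Da Db Dc] _ _]] := good S FS (nz _ _ St).
    by split; exact: up Da || exact: up Db || exact: up Dc.
  - have [S [FS Sa Sb]] := both _ _ ac bd.
    have [_ [_ + _]] := good S FS (nz _ _ Sa).
    move=> /(_ a b)[||c' Sc'']; [by exists c|by exists d|].
    by exists c', S.
  - have [S [FS Sa Sb]] := both _ _ H H'.
    have [_ [_ _ ]] := good S FS (nz _ _ Sa); exact.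
have RN0 : R <> set0.
  move=> E; apply: (Rmax R0); last by right; split.
  rewrite E; split=> // /(_ (e 0, e 0, e (pickle (0, 0)))).
  by apply; exists 0, 0.
case: PR => // -[R0R [Rdom Rtot Rinj]].
pose A := {a | dom R a}.
have [f Rf] : exists f : A * A -> A, forall p,
    R (sval p.1, sval p.2, sval (f p)).
  suff /choice[f] : forall p : A * A, exists c : A, R (sval p.1, sval p.2, sval c).
    by exists f.
  move=> [[a Da] [b Db]] /=; have [c Rc] := Rtot _ _ Da Db.
  by have [_ _ Dc] := Rdom _ _ _ Rc; exists (exist _ c Dc).
have fI : injective f.
  move=> p q /(congr1 sval) /(Rinj _ _ _ _ _ _ (Rf p) (Rf q)) [].
  by case: p q => [? ?] [? ?] /= /sval_inj -> /sval_inj ->.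
have eA n : dom R (e n).
  have [c ?] := (dom0 (e n)).2 (ex_intro _ n erefl).
  by exists c; exact: R0R.
pose z0 : A := exist _ (e 0) (eA 0); pose z1 : A := exist _ (e 1) (eA 1).
have z01 : z0 <> z1 by move=> /(congr1 sval) /= /eI.
pose B := {b | ~ dom R b}.
have [[g gI]|[g gI]] := injects_total B A.
  pose u x := match pselect (dom R x) with
    | left h => f (z0, exist _ x h) | right h => f (z1, g (exist _ x h)) end.
  have uI : injective u.
    move=> x y; rewrite /u.
    case: (pselect (dom R x)) => [p|p]; case: (pselect (dom R y)) => [q|q] /fI [].
    - by [].
    - by move=> /eI.
    - by move=> /eI.
    - by move=> /gI [].
  exists (fun p => sval (f (u p.1, u p.2))) => -[a b] [a' b'] /= E.
  by move: E => /sval_inj /fI [/uI -> /uI ->].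
pose A' : set K := [set x | dom R x \/ exists a, x = sval (g a)].
have gN a : ~ dom R (sval (g a)) := svalP (g a).
(* [A'] consists of two copies of [A], tagged by [z0] and [z1]; elsewhere [u] takes the default
   value [z0], so its injectivity is restricted to [A']. *)
have [u uI] : exists u : K -> A, forall x y, A' x -> A' y -> u x = u y -> x = y.
  have H x : exists c : A, (exists2 h : dom R x, True & c = f (z0, exist _ x h)) \/
     (~ dom R x /\ forall a, x = sval (g a) -> c = f (z1, a)).
    have [h|h] := pselect (dom R x).
      by exists (f (z0, exist _ x h)); left; exists h.
    have [[a ->]|N] := pselect (exists a, x = sval (g a)).
      exists (f (z1, a)); right; split; first exact: gN.
      by move=> a' E; move: E => /sval_inj /gI ->.
    by exists z0; right; split=> // a E; case: N; exists a.
  have [u Hu] := choice H; exists u => x y A'x A'y uxy.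
  move: (Hu x) (Hu y) => [[h _ ux]|[hx ux]] [[h' _ uy]|[hy uy]].
  - by move: uxy; rewrite ux uy => /fI [].
  - case: A'y => // -[a ya]; move: uxy; rewrite ux (uy a ya) => /fI [] /eI //.
  - case: A'x => // -[a xa]; move: uxy; rewrite uy (ux a xa) => /fI [] /eI //.
  - case: A'x => // -[a xa]; case: A'y => // -[b yb].
    by move: uxy; rewrite (ux a xa) (uy b yb) xa yb => /fI [->].
(* The values of [h] lie in the image of [g], outside [dom R], so a new triple never shares its
   value with a triple of [R]. *)
pose h a b := sval (g (f (u a, u b))).
pose N := [set t : K * K * K | [/\ A' t.1.1, A' t.1.2,
  ~ (dom R t.1.1 /\ dom R t.1.2) & t.2 = h t.1.1 t.1.2]].
have domU a : dom (R `|` N) a <-> A' a.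
  split=> [[c [Rc|[]//]]|]; first by left; exists c.
  have [[c ac] _|Na A'a] := pselect (dom R a); first by exists c; left.
  by exists (h a a); right; split=> //= -[].
have hA' a b : A' (h a b) by right; eexists.
case: (Rmax (R `|` N)).
  split; first by move=> t; left.
  move=> /(_ (sval (g z0), sval (g z0), h (sval (g z0)) (sval (g z0)))) H.
  have A'g : A' (sval (g z0)) by right; exists z0.
  have /Rdom[/gN//] : R (sval (g z0), sval (g z0), h (sval (g z0)) (sval (g z0))).
  by apply: H; right; split=> //= -[/gN].
right; split; first by move=> t /R0R; left.
split=> [a b c [Rt|[/= A'a A'b _ ->]]|a b /domU A'a /domU A'b|a b c a' b' c'].
- by have [Da Db Dc] := Rdom _ _ _ Rt; split; apply/domU; left.
- by split; apply/domU.
- have [[Da Db]|ND] := pselect (dom R a /\ dom R b).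
    by have [c Rc] := Rtot _ _ Da Db; exists c; left.
  by exists (h a b); right.
- have hI x y x' y' : A' x -> A' y -> A' x' -> A' y' ->
      h x y = h x' y' -> x = x' /\ y = y'.
    move=> Ax Ay Ax' Ay' /sval_inj.
    by move=> /gI /fI [/uI -> // /uI ->].
  move=> [Rt|[/= A1 A2 ND ->]] [Rt'|[/= A1' A2' ND' ->]].
  + exact: Rinj.
  + have [Da Db Dc] := Rdom _ _ _ Rt; split=> [[E1 E2]|E].
      by case: ND'; rewrite -E1 -E2.
    by case: (gN (f (u a', u b'))); rewrite -/(h a' b') -E.
  + have [Da Db Dc] := Rdom _ _ _ Rt'; split=> [[E1 E2]|E].
      by case: ND; rewrite E1 E2.
    by case: (gN (f (u a, u b))); rewrite -/(h a b) E.
  + by split=> [[-> ->]//|]; exact: hI.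
Qed.

End Square.

Local Open Scope ring_scope.
Local Open Scope cat_scope.

(** * Preadditive and abelian categories *)

Section Preadditive.
Variable C : preadditive.
Implicit Types A B D W : C.

Lemma compm0 A B D (g : mor B D) : g \oc (0 : mor A B) = 0.
Proof. by apply: (addrI (g \oc 0)); rewrite -compDr !addr0. Qed.

Lemma comp0m A B D (f : mor A B) : (0 : mor B D) \oc f = 0.
Proof. by apply: (addrI (0 \oc f)); rewrite -compDl !addr0. Qed.

Lemma compmN A B D (g : mor B D) (f : mor A B) : g \oc (- f) = - (g \oc f).
Proof. by apply: (addrI (g \oc f)); rewrite -compDr !subrr compm0. Qed.

Lemma compNm A B D (g : mor B D) (f : mor A B) : (- g) \oc f = - (g \oc f).
Proof. by apply: (addrI (g \oc f)); rewrite -compDl !subrr comp0m. Qed.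

Lemma compBr A B D (g : mor B D) (f f' : mor A B) :
  g \oc (f - f') = g \oc f - g \oc f'.
Proof. by rewrite compDr compmN. Qed.

Lemma compBl A B D (g g' : mor B D) (f : mor A B) :
  (g - g') \oc f = g \oc f - g' \oc f.
Proof. by rewrite compDl compNm. Qed.

Lemma epi0P A B (f : mor A B) :
  epi f <-> forall W (g : mor B W), g \oc f = 0 -> g = 0.
Proof.
split=> [fe W g fg|f0 W g h fgh]; first by apply: fe; rewrite fg comp0m.
by apply/eqP; rewrite -subr_eq0; apply/eqP/f0; rewrite compBl fgh subrr.
Qed.

Lemma kernel_mono K A B (k : mor K A) (f : mor A B) : is_kernel k f -> mono k.
Proof.
move=> [fk ku] W g h kgh; have [|x [_ xu]] := ku W (k \oc g).
  by rewrite ccompA fk comp0m.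
by rewrite -(xu g erefl) (xu h).
Qed.

Lemma kernel_lift K A B (k : mor K A) (f : mor A B) : is_kernel k f ->
  forall W (g : mor W A), f \oc g = 0 -> exists h : mor W K, k \oc h = g.
Proof. by move=> [_ ku] W g /ku[h [kh _]]; exists h. Qed.

Lemma is_kernelP K A B (k : mor K A) (f : mor A B) : mono k -> f \oc k = 0 ->
  (forall W (g : mor W A), f \oc g = 0 -> exists h : mor W K, k \oc h = g) ->
  is_kernel k f.
Proof.
move=> km fk kl; split=> // W g /kl[h kh]; exists h; split=> // h' kh'.
by apply: km; rewrite kh kh'.
Qed.

Lemma mono_comp A B D (g : mor B D) (f : mor A B) : mono g -> mono f -> mono (g \oc f).
Proof. by move=> gm fm W x y; rewrite -!ccompA => /gm /fm. Qed.

Lemma epi_comp A B D (g : mor B D) (f : mor A B) : epi g -> epi f -> epi (g \oc f).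
Proof. by move=> ge fe W x y; rewrite !ccompA => /fe /ge. Qed.

Lemma mono_of_comp A B D (g : mor B D) (f : mor A B) : mono (g \oc f) -> mono f.
Proof. by move=> gfm W x y fxy; apply: gfm; rewrite -!ccompA fxy. Qed.

Lemma epi_of_comp A B D (g : mor B D) (f : mor A B) : epi (g \oc f) -> epi g.
Proof. by move=> gfe W x y fxy; apply: gfe; rewrite !ccompA fxy. Qed.

Lemma mono_of_retraction A B (f : mor A B) (r : mor B A) : r \oc f = idm A -> mono f.
Proof. by move=> rf W x y fxy; rewrite -[x]comp1m -[y]comp1m -rf -!ccompA fxy. Qed.

Lemma epi_of_section A B (f : mor A B) (s : mor B A) : f \oc s = idm B -> epi f.
Proof. by move=> fs W x y fxy; rewrite -[x]compm1 -[y]compm1 -fs !ccompA fxy. Qed.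

Definition is_pullback A B D P (f : mor A D) (g : mor B D)
    (p : mor P A) (q : mor P B) :=
  f \oc p = g \oc q /\
  forall W (x : mor W A) (y : mor W B), f \oc x = g \oc y ->
    exists! t : mor W P, p \oc t = x /\ q \oc t = y.

Lemma pullback_sym A B D P (f : mor A D) (g : mor B D) (p : mor P A) (q : mor P B) :
  is_pullback f g p q -> is_pullback g f q p.
Proof.
move=> [fg u]; split=> // W x y xy; have [t [[pt qt] tu]] := u W y x (esym xy).
by exists t; split=> // t' []; exact: (fun a b => tu t' (conj b a)).
Qed.

Lemma pullback_joint_mono A B D P (f : mor A D) (g : mor B D)
    (p : mor P A) (q : mor P B) :
  is_pullback f g p q ->
  forall W (x y : mor W P), p \oc x = p \oc y -> q \oc x = q \oc y -> x = y.
Proof.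
move=> [fg u] W x y px qx; have [|t [_ tu]] := u W (p \oc y) (q \oc y).
  by rewrite !ccompA fg.
by rewrite -(tu x) // -(tu y).
Qed.

Lemma pullback_kernel A B D P K (f : mor A D) (g : mor B D) (p : mor P A)
    (q : mor P B) (k : mor K A) :
  is_pullback f g p q -> is_kernel k f ->
  exists2 k' : mor K P, p \oc k' = k & is_kernel k' q.
Proof.
move=> pb kf; have [k' [[pk' qk'] _]] : exists! t : mor K P, p \oc t = k /\ q \oc t = 0.
  by apply: pb.2; rewrite compm0 kf.1.
exists k' => //; apply: is_kernelP => //.
  by apply: (@mono_of_comp _ _ _ p); rewrite pk'; exact: kernel_mono kf.
move=> W x qx; have [|h kh] := kernel_lift kf (g := p \oc x).
  by rewrite ccompA pb.1 -ccompA qx compm0.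
by exists h; apply: (pullback_joint_mono pb); rewrite ccompA ?pk' ?qk' ?comp0m.
Qed.

Lemma pullback_of_kernel A B D P Q (f : mor A D) (g : mor B D) (p : mor P A)
    (q : mor P B) (b : mor D Q) :
  is_pullback f g p q -> is_kernel g b -> is_kernel p (b \oc f).
Proof.
move=> pb gb; apply: is_kernelP.
- move=> W x y pxy; apply: (pullback_joint_mono pb) => //.
  by apply: (kernel_mono gb); rewrite !ccompA -pb.1 -!ccompA pxy.
- by rewrite -ccompA pb.1 ccompA gb.1 comp0m.
- move=> W x; rewrite -ccompA => /(kernel_lift gb)[y gy].
  have [t [[pt _] _]] := pb.2 W x y (esym gy); by exists t.
Qed.

Lemma biproduct_pair A B S (i : mor A S) (j : mor B S) (p : mor S A) (q : mor S B) :
  is_biproduct i j p q -> forall W (x : mor W A) (y : mor W B),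
  p \oc (i \oc x + j \oc y) = x /\ q \oc (i \oc x + j \oc y) = y.
Proof.
move=> [pi qj pj qi _] W x y.
by rewrite !compDr !ccompA pi qj pj qi !comp1m !comp0m addr0 add0r.
Qed.

Lemma biproduct_copair A B S (i : mor A S) (j : mor B S) (p : mor S A) (q : mor S B) :
  is_biproduct i j p q -> forall W (x : mor A W) (y : mor B W),
  (x \oc p + y \oc q) \oc i = x /\ (x \oc p + y \oc q) \oc j = y.
Proof.
move=> [pi qj pj qi _] W x y.
by rewrite !compDl -!ccompA pi qj pj qi !compm1 !compm0 addr0 add0r.
Qed.

End Preadditive.

(** * Duality through the opposite category *)

Section Opposite.

(** Kept transparent, so that a lemma applied in the opposite category reads as its dual by
    conversion. *)
Definition op_cat (C : preadditive) : preadditive.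
Proof.
refine (@Preadditive C (fun A B => @mor C B A) (@idm C)
  (fun A B D g f => @ccomp C D B A f g) _ _ _ _ _).
- by move=> *; rewrite ccompA.
- by move=> *; rewrite compm1.
- by move=> *; rewrite comp1m.
- by move=> *; rewrite compDr.
- by move=> *; rewrite compDl.
Defined.

Lemma op_cat_abelian (C : abelianCat) : is_abelian (op_cat C).
Proof.
have [az ab ak ac am ae] := ab_axioms C; split.
- by have [Z Zz] := az; exists Z => W; have [] := Zz W.
- move=> A B; have [S [i [j [p [q [pi qj pj qi s]]]]]] := ab A B.
  by exists S, p, q, i, j; split.
- by move=> A B f; exact: (ac B A f).
- by move=> A B f; exact: (ak B A f).
- by move=> A B f; exact: (ae B A f).
- by move=> A B f; exact: (am B A f).
Qed.

Definition op_abelian (C : abelianCat) : abelianCat := AbelianCat (op_cat_abelian C).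

End Opposite.

Section Duals.
Variable C : abelianCat.
Implicit Types A B D W : C.
Notation op := (op_abelian C).

Lemma cokernel_epi A B Q (f : mor A B) (q : mor B Q) : is_cokernel f q -> epi q.
Proof. exact: (@kernel_mono op). Qed.

Lemma cokernel_desc A B Q (f : mor A B) (q : mor B Q) : is_cokernel f q ->
  forall W (g : mor B W), g \oc f = 0 -> exists h : mor Q W, h \oc q = g.
Proof. exact: (@kernel_lift op). Qed.

Lemma is_cokernelP A B Q (f : mor A B) (q : mor B Q) : epi q -> q \oc f = 0 ->
  (forall W (g : mor B W), g \oc f = 0 -> exists h : mor Q W, h \oc q = g) ->
  is_cokernel f q.
Proof. exact: (@is_kernelP op). Qed.

(** [f] is the kernel of some [g], and [g] factors through [q]; hence a map killed by [q] is killed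
    by [g] and lifts through [f]. *)
Lemma mono_kernel A B Q (f : mor A B) (q : mor B Q) :
  mono f -> is_cokernel f q -> is_kernel f q.
Proof.
move=> fm fq; have [D [g fg]] := ab_mono (ab_axioms C) fm.
apply: is_kernelP => //; first exact: fq.1.
move=> W x qx; have [g' gE] := cokernel_desc fq fg.1.
by apply: (kernel_lift fg); rewrite -gE -ccompA qx compm0.
Qed.

End Duals.

Lemma epi_cokernel (C : abelianCat) (K A B : C) (k : mor K A) (f : mor A B) :
  epi f -> is_kernel k f -> is_cokernel k f.
Proof. exact: (@mono_kernel (op_abelian C)). Qed.

(** * Short exact sequences, their pullbacks and pushouts *)

Lemma ses_mono (C : abelianCat) (A B D : C) (f : mor A B) (g : mor B D) :
  short_exact f g -> mono f.
Proof. by move=> [/kernel_mono]. Qed.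

Lemma ses_epi (C : abelianCat) (A B D : C) (f : mor A B) (g : mor B D) :
  short_exact f g -> epi g.
Proof. by move=> [_ /cokernel_epi]. Qed.

Lemma ses_comp0 (C : abelianCat) (A B D : C) (f : mor A B) (g : mor B D) :
  short_exact f g -> g \oc f = 0.
Proof. by move=> [[]]. Qed.

Lemma ses_op (C : abelianCat) (A B D : C) (f : mor A B) (g : mor B D) :
  short_exact f g -> @short_exact (op_abelian C) D B A g f.
Proof. by case. Qed.

Lemma mono_ses (C : abelianCat) (A B : C) (f : mor A B) :
  mono f -> exists D (g : mor B D), short_exact f g.
Proof.
move=> fm; have [Q [q fq]] := ab_cokernel (ab_axioms C) f.
by exists Q, q; split=> //; exact: mono_kernel.
Qed.

Lemma epi_ses (C : abelianCat) (A B : C) (g : mor A B) :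
  epi g -> exists K (k : mor K A), short_exact k g.
Proof. by move=> /(@mono_ses (op_abelian C))[K [k /ses_op]]; exists K, k. Qed.

Lemma biproduct_joint_mono (C : preadditive) (A B S : C) (i : mor A S) (j : mor B S)
    (p : mor S A) (q : mor S B) : is_biproduct i j p q ->
  forall W (x y : mor W S), p \oc x = p \oc y -> q \oc x = q \oc y -> x = y.
Proof.
move=> bip W x y px qx.
by rewrite -[x]comp1m -[y]comp1m -(biprod_sum bip) !compDl -!ccompA px qx.
Qed.

Lemma pullback_exists (C : abelianCat) (A B D : C) (f : mor A D) (g : mor B D) :
  exists P (p : mor P A) (q : mor P B), is_pullback f g p q.
Proof.
have [S [i [j [p [q bip]]]]] := ab_biprod (ab_axioms C) A B.
have [P [k kk]] := ab_kernel (ab_axioms C) (f \oc p - g \oc q).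
exists P, (p \oc k), (q \oc k); split.
  by apply/eqP; rewrite -subr_eq0 !ccompA -compBl kk.1.
move=> W x y fxgy; have [px qy] := biproduct_pair bip x y.
have [|t kt] := kernel_lift kk (g := i \oc x + j \oc y).
  by rewrite compBl -!ccompA px qy fxgy subrr.
exists t; split=> [|t' [xE yE]]; first by rewrite -!ccompA kt.
apply: (kernel_mono kk); rewrite kt.
by apply: (biproduct_joint_mono bip); rewrite ?px ?qy ccompA.
Qed.

(* If [u] kills the pullback projection [q], then [(0, u)] kills the kernel of
   the epimorphism [(f, -g)] and so factors through [D], by a map killing [f]. *)
Lemma pullback_epi (C : abelianCat) (A B D P : C) (f : mor A D) (g : mor B D)
    (p : mor P A) (q : mor P B) : is_pullback f g p q -> epi f -> epi q.
Proof.
move=> pb fe; apply/epi0P => W u uq0.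
have [S [i [j [pS [qS bip]]]]] := ab_biprod (ab_axioms C) A B.
pose d := f \oc pS - g \oc qS.
have di : d \oc i = f.
  by rewrite compBl -!ccompA (biprod_pi bip) (biprod_qi bip) compm1 compm0 subr0.
have dj : d \oc j = - g.
  by rewrite compBl -!ccompA (biprod_pj bip) (biprod_qj bip) compm1 compm0 sub0r.
have de : epi d by apply: (@epi_of_comp _ _ _ _ d i); rewrite di.
have [K [k kk]] := ab_kernel (ab_axioms C) d.
have [|v vE] := cokernel_desc (epi_cokernel de kk) (g := u \oc qS).
  have [|t [[_ qt] _]] := pb.2 _ (pS \oc k) (qS \oc k).
    by apply/eqP; rewrite -subr_eq0 !ccompA -compBl kk.1.
  by rewrite -ccompA -qt ccompA uq0 comp0m.
have v0 : v = 0.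
  apply: ((epi0P f).1 fe); rewrite -di ccompA vE -ccompA (biprod_qi bip).
  exact: compm0.
by rewrite -[u]compm1 -(biprod_qj bip) ccompA -vE v0 !comp0m.
Qed.

Lemma pullback_ses (C : abelianCat) (A B D P K : C) (f : mor A D) (g : mor B D)
    (p : mor P A) (q : mor P B) (k : mor K A) :
  is_pullback f g p q -> short_exact k f ->
  exists2 k' : mor K P, p \oc k' = k & short_exact k' q.
Proof.
move=> pb kf; have [k' pk' k'q] := pullback_kernel pb kf.1.
exists k' => //; split=> //; apply: epi_cokernel => //.
by apply: pullback_epi pb _; exact: ses_epi kf.
Qed.

(** Since [a] is the kernel of [b], the pullback of [n] and [a] is the kernel of [b \oc n]; as a
    base change of [n] it is also an extension of [A] by [K]. *)
Lemma pullback_mono_ses (C : abelianCat) (N A Y D K : C) (n : mor N Y) (a : mor A Y)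
    (k : mor K N) (b : mor Y D) : short_exact k n -> short_exact a b ->
  exists P (k' : mor K P) (n' : mor P A) (a' : mor P N),
    [/\ short_exact k' n', short_exact a' (b \oc n), a' \oc k' = k & n \oc a' = a \oc n'].
Proof.
move=> kn ab; have [P [a' [n' pb]]] := pullback_exists n a.
have [k' a'k' k'n'] := pullback_ses pb kn.
exists P, k', n', a'; split=> //; last exact: pb.1.
have ker := pullback_of_kernel pb ab.1.
split=> //; apply: epi_cokernel => //.
by apply: epi_comp; [exact: ses_epi ab | exact: ses_epi kn].
Qed.

Lemma pullback_epi_ses (C : abelianCat) (A B D K M : C) (f : mor A D) (g : mor B D)
    (k : mor K A) (m : mor M B) : short_exact k f -> short_exact m g ->
  exists P (p : mor P A) (q : mor P B) (k' : mor K P) (m' : mor M P),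
    [/\ short_exact k' q, short_exact m' p, p \oc k' = k, q \oc m' = m &
        f \oc p = g \oc q].
Proof.
move=> kf mg; have [P [p [q pb]]] := pullback_exists f g.
have [k' pk' k'q] := pullback_ses pb kf.
have [m' qm' m'p] := pullback_ses (pullback_sym pb) mg.
by exists P, p, q, k', m'; split=> //; exact: pb.1.
Qed.

Lemma pushout_epi_ses (C : abelianCat) (D Y A N K : C) (n : mor Y N) (a : mor Y A)
    (k : mor N K) (b : mor D Y) : short_exact n k -> short_exact b a ->
  exists P (k' : mor P K) (n' : mor A P) (a' : mor N P),
    [/\ short_exact n' k', short_exact (n \oc b) a', k' \oc a' = k & a' \oc n = n' \oc a].
Proof.
move=> /ses_op nk /ses_op ba.
have [P [k' [n' [a' [/ses_op ? /ses_op ? ? ?]]]]] := pullback_mono_ses nk ba.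
by exists P, k', n', a'.
Qed.

Lemma pushout_mono_ses (C : abelianCat) (D A B K M : C) (f : mor D A) (g : mor D B)
    (k : mor A K) (m : mor B M) : short_exact f k -> short_exact g m ->
  exists P (p : mor A P) (q : mor B P) (k' : mor P K) (m' : mor P M),
    [/\ short_exact q k', short_exact p m', k' \oc p = k, m' \oc q = m &
        p \oc f = q \oc g].
Proof.
move=> /ses_op fk /ses_op gm.
have [P [p [q [k' [m' [/ses_op ? /ses_op ? ? ? ?]]]]]] := pullback_epi_ses fk gm.
by exists P, p, q, k', m'.
Qed.

(** * Split sequences and vanishing of [Ext1] *)

Lemma retraction_biproduct (C : abelianCat) (A S : C) (i : mor A S) (p : mor S A) :
  p \oc i = idm A -> exists B (j : mor B S) (q : mor S B), is_biproduct i j p q.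
Proof.
move=> pi; have [B [j jp]] := ab_kernel (ab_axioms C) p.
have [|q jq] := kernel_lift jp (g := idm S - i \oc p).
  by rewrite compBr compm1 ccompA pi comp1m subrr.
have jm := kernel_mono jp.
exists B, j, q; split=> //.
- by apply: jm; rewrite ccompA jq compBl comp1m -ccompA jp.1 compm0 subr0 compm1.
- exact: jp.1.
- by apply: jm; rewrite ccompA jq compBl comp1m -ccompA pi compm1 subrr compm0.
- by rewrite jq addrC subrK.
Qed.

Lemma ses_section (C : abelianCat) (A E X : C) (f : mor A E) (g : mor E X)
    (r : mor E A) :
  short_exact f g -> r \oc f = idm A ->
  exists2 s, g \oc s = idm X & is_biproduct f s r g.
Proof.
move=> fg rf; have [|s sg] := cokernel_desc fg.2 (g := idm E - f \oc r).
  by rewrite compBl comp1m -ccompA rf compm1 subrr.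
have ge := ses_epi fg; have gf := ses_comp0 fg.
have gs : g \oc s = idm X.
  by apply: ge; rewrite -ccompA sg compBr ccompA gf comp0m subr0 comp1m compm1.
exists s => //; split=> //; last by rewrite sg addrC subrK.
by apply: ge; rewrite -ccompA sg comp0m compBr compm1 ccompA rf comp1m subrr.
Qed.

Lemma ses_retraction (C : abelianCat) (A E X : C) (f : mor A E) (g : mor E X)
    (s : mor X E) :
  short_exact f g -> g \oc s = idm X -> exists r, r \oc f = idm A.
Proof. by move=> /ses_op fg /(ses_section fg)[r]; exists r. Qed.

(** A map to a split extension, followed by the projection onto [A], is a retraction of [f]; a
    one-sided inverse at either end of a short exact sequence makes its middle term a biproduct. *)
Lemma Ext1_eq0P (C : abelianCat) (X A : C) :
  Ext1_eq0 X A <-> forall E (f : mor A E) (g : mor E X), short_exact f g ->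
    exists s, g \oc s = idm X.
Proof.
split=> [H E f g fg|H [E f g fg]].
  have [e0 [j [p bip]] [h [hf gh]]] := H (Extension fg).
  have [|s gs _] := @ses_section _ _ _ _ f g (p \oc h) fg; last by exists s.
  by rewrite -ccompA hf (biprod_pi bip).
have [s gs] := H _ _ _ fg; have [r rf] := ses_retraction fg gs.
have [s' _ bip] := ses_section fg rf.
exists (Extension fg); first by exists s', r.
by exists (idm E) => /=; rewrite comp1m compm1.
Qed.

Lemma Ext1_eq0_op (C : abelianCat) (X A : C) :
  Ext1_eq0 X A -> @Ext1_eq0 (op_abelian C) A X.
Proof.
move=> /Ext1_eq0P H; apply/Ext1_eq0P => E f g /ses_op fg.
by have [s gs] := H _ _ _ fg; exact: ses_retraction fg gs.
Qed.

(** The pullback of the sequence along [u] is an extension of [X] by [A], so it splits; a section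
    followed by the projection to [B] is the lift. *)
Lemma Ext1_lift (C : abelianCat) (X A B D : C) (f : mor A B) (g : mor B D) :
  Ext1_eq0 X A -> short_exact f g -> forall u : mor X D, exists v, g \oc v = u.
Proof.
move=> /Ext1_eq0P H fg u; have [P [p [q pb]]] := pullback_exists g u.
have [k _ kq] := pullback_ses pb fg; have [s qs] := H _ _ _ kq.
by exists (p \oc s); rewrite ccompA pb.1 -ccompA qs compm1.
Qed.

Lemma Ext1_extend (C : abelianCat) (X A B D : C) (f : mor B D) (g : mor D X) :
  Ext1_eq0 X A -> short_exact f g -> forall u : mor B A, exists v, v \oc f = u.
Proof. by move=> /Ext1_eq0_op H /ses_op fg u; exact: (Ext1_lift H fg). Qed.

Lemma Ext1_retraction (C : abelianCat) (X A E : C) (f : mor A E) (g : mor E X) :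
  Ext1_eq0 X A -> short_exact f g -> exists r, r \oc f = idm A.
Proof. by move=> H fg; exact: (Ext1_extend H fg). Qed.

Lemma Ext1_section (C : abelianCat) (X A E : C) (f : mor A E) (g : mor E X) :
  Ext1_eq0 X A -> short_exact f g -> exists s, g \oc s = idm X.
Proof. by move=> H fg; exact: (Ext1_lift H fg). Qed.

(** This replaces the long exact sequence: restricted to [A], an extension of [E] by [Y] has a
    retraction onto [Y], which extends to the whole middle term because the cokernel of the
    restriction is [X]. *)
Lemma Ext1_middle (C : abelianCat) (A E X Y : C) (f : mor A E) (g : mor E X) :
  short_exact f g -> Ext1_eq0 A Y -> Ext1_eq0 X Y -> Ext1_eq0 E Y.
Proof.
move=> fg HA HX; apply/Ext1_eq0P => B k n kn.
have [P [k' [n' [a [k'n' an ak' _]]]]] := pullback_mono_ses kn fg.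
have [r rk'] := Ext1_retraction HA k'n'.
have [v va] := Ext1_extend HX an r.
have vk : v \oc k = idm Y by rewrite -ak' ccompA va.
by have [s ? _] := ses_section kn vk; exists s.
Qed.

Lemma Ext1_retract (C : abelianCat) (A S Y : C) (i : mor A S) (p : mor S A) :
  p \oc i = idm A -> Ext1_eq0 S Y -> Ext1_eq0 A Y.
Proof.
move=> pi H; apply/Ext1_eq0P => E f g fg; have [v gv] := Ext1_lift H fg p.
by exists (v \oc i); rewrite ccompA gv.
Qed.

(** Lifts of the single injections assemble, by the universal property, into a section of any
    extension of [S]. *)
Lemma Ext1_coproduct (C : abelianCat) (I : Type) (X : I -> C) (S Y : C)
    (inj : forall i, mor (X i) S) :
  is_coproduct inj -> (forall i, Ext1_eq0 (X i) Y) -> Ext1_eq0 S Y.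
Proof.
move=> co H; apply/Ext1_eq0P => E f g fg.
pose lift i := cid (Ext1_lift (H i) fg (inj i)).
have [h [hs _]] := co _ (fun i => projT1 (lift i)); exists h.
have [t [_ tu]] := co _ inj; rewrite -(tu (idm S)); last by move=> i; rewrite comp1m.
by apply/esym/tu => i; rewrite -ccompA hs; exact: projT2 (lift i).
Qed.

Lemma biproduct_ses (C : abelianCat) (A B S : C) (i : mor A S) (j : mor B S)
    (p : mor S A) (q : mor S B) : is_biproduct i j p q -> short_exact i q.
Proof.
move=> [pi qj _ qi sum].
have iq : is_kernel i q.
  apply: is_kernelP => //; first exact: mono_of_retraction pi.
  move=> W x qx; exists (p \oc x).
  by rewrite -[RHS]comp1m -sum compDl -!ccompA qx compm0 addr0.
by split=> //; apply: epi_cokernel iq; exact: epi_of_section qj.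
Qed.

Lemma cokernel_comp_epi (C : abelianCat) (L K A B : C) (e : mor L K) (k : mor K A)
    (g : mor A B) : epi e -> is_cokernel k g -> is_cokernel (k \oc e) g.
Proof.
move=> ee kg; apply: is_cokernelP; first exact: cokernel_epi kg.
  by rewrite ccompA kg.1 comp0m.
by move=> W u; rewrite ccompA => /((epi0P e).1 ee) /(cokernel_desc kg).
Qed.

(** If [c] kills [f'] and [m] is the kernel of [c], then [f] factors through [k \oc m]. The cokernel
    of [k \oc m] thus factors through [g] and kills [k], so [m] has a section and [c = 0]. *)
Lemma cokernel_kernel_epi (C : abelianCat) (M N A K : C) (f : mor M N) (g : mor N A)
    (k : mor K N) :
  is_cokernel f g -> is_kernel k g -> exists2 f' : mor M K, epi f' & k \oc f' = f.
Proof.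
move=> fg kg; have [f' kf'] := kernel_lift kg fg.1.
exists f' => //; apply/epi0P => W c cf'0.
have [K' [m mc]] := ab_kernel (ab_axioms C) c.
have [t mt] := kernel_lift mc cf'0.
have [D [d kmd]] := mono_ses (mono_comp (kernel_mono kg) (kernel_mono mc)).
have [|d' d'g] := cokernel_desc fg (g := d).
  by rewrite -kf' -mt [k \oc _]ccompA ccompA (ses_comp0 kmd) comp0m.
have [|s kms] := kernel_lift kmd.1 (g := k).
  by rewrite -d'g -ccompA kg.1 compm0.
have ms : m \oc s = idm K by apply: (kernel_mono kg); rewrite ccompA kms compm1.
by rewrite -[c]compm1 -ms ccompA mc.1 comp0m.
Qed.

(** * Existing copowers *)

Lemma coproduct_joint_epi (C : preadditive) (I : Type) (X : I -> C) (S W : C)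
    (inj : forall i, mor (X i) S) : is_coproduct inj ->
  forall x y : mor S W, (forall i, x \oc inj i = y \oc inj i) -> x = y.
Proof.
move=> co x y xy; have [h [_ hu]] := co W (fun i => y \oc inj i).
by rewrite -(hu x) // (hu y).
Qed.

Lemma coproduct_desc (C : preadditive) (I : Type) (X : I -> C) (S W : C)
    (inj : forall i, mor (X i) S) : is_coproduct inj ->
  forall f : forall i, mor (X i) W, exists h : mor S W, forall i, h \oc inj i = f i.
Proof. by move=> co f; have [h [hf _]] := co W f; exists h. Qed.

Lemma is_coproductP (C : preadditive) (I : Type) (X : I -> C) (S : C)
    (inj : forall i, mor (X i) S) :
  (forall W (x y : mor S W), (forall i, x \oc inj i = y \oc inj i) -> x = y) ->
  (forall W (f : forall i, mor (X i) W),
    exists h : mor S W, forall i, h \oc inj i = f i) ->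
  is_coproduct inj.
Proof.
move=> u e W f; have [h hf] := e W f; exists h; split=> // h' h'f.
by apply: u => i; rewrite hf h'f.
Qed.

Definition has_copower (C : abelianCat) (V : C) (I : Type) : Prop :=
  exists S, is_copower V I S.

Lemma copower_unit (C : abelianCat) (V : C) : is_copower V unit V.
Proof.
exists (fun=> idm V); apply: is_coproductP => [W x y /(_ tt)|W f].
  by rewrite !compm1.
by exists (f tt) => -[]; rewrite compm1.
Qed.

Lemma copower_sum (C : abelianCat) (V : C) (I J : Type) (A B S : C)
    (i : mor A S) (j : mor B S) (p : mor S A) (q : mor S B) :
  is_biproduct i j p q -> is_copower V I A -> is_copower V J B -> is_copower V (I + J) S.
Proof.
move=> bip [a ca] [b cb].
exists (fun s => match s with inl x => i \oc a x | inr y => j \oc b y end).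
apply: is_coproductP => [W x y xy|W f].
  have xyi : x \oc i = y \oc i.
    by apply: (coproduct_joint_epi ca) => k; rewrite -!ccompA (xy (inl k)).
  have xyj : x \oc j = y \oc j.
    by apply: (coproduct_joint_epi cb) => k; rewrite -!ccompA (xy (inr k)).
  rewrite -[x]compm1 -[y]compm1 -(biprod_sum bip) !compDr !ccompA.
  by rewrite xyi xyj.
have [h hf] := coproduct_desc ca (fun x => f (inl x)).
have [h' h'f] := coproduct_desc cb (fun x => f (inr x)).
have [hi hj] := biproduct_copair bip h h'.
by exists (h \oc p + h' \oc q) => -[] x; rewrite ccompA ?hi ?hj.
Qed.

Lemma has_copower_sum (C : abelianCat) (V : C) (I J : Type) :
  has_copower V I -> has_copower V J -> has_copower V (I + J).
Proof.
move=> [A cA] [B cB]; have [S [i [j [p [q bip]]]]] := ab_biprod (ab_axioms C) A B.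
by exists S; exact: copower_sum bip cA cB.
Qed.

(* The idempotent of [V^(I)] that kills the copies of [V] outside the image of
   [J] splits, and its image is [V^(J)]. *)
Lemma has_copower_injects (C : abelianCat) (V : C) (I J : Type) :
  injects J I -> has_copower V I -> has_copower V J.
Proof.
move=> [phi phiI] [S [inj co]].
have extend W (g : J -> mor V W) : exists h : mor S W,
    (forall j, h \oc inj (phi j) = g j) /\
    (forall i, ~ (exists j, phi j = i) -> h \oc inj i = 0).
  pose f i := match pselect (exists j, phi j = i) with
    | left e => g (projT1 (cid e)) | right _ => 0 end.
  have [h hf] := coproduct_desc co f; exists h; split=> [j|i N]; rewrite hf /f.
    case: pselect => [e|[]]; last by exists j.
    by case: (cid e) => j' /= /phiI ->.
  by case: pselect.
have [e [ej e0]] := extend S (fun j => inj (phi j)).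
have ee : e \oc e = e.
  apply: (coproduct_joint_epi co) => i; rewrite -ccompA.
  have [[j <-]|N] := pselect (exists j, phi j = i); first by rewrite !ej.
  by rewrite e0 // compm0.
have [T [k ker]] := ab_kernel (ab_axioms C) (idm S - e).
have km := kernel_mono ker.
have [|r kr] := kernel_lift ker (g := e).
  by rewrite compBl comp1m ee subrr.
have ek : e \oc k = k.
  by apply/esym/eqP; rewrite -subr_eq0 -[X in X - _]comp1m -compBl ker.1.
have rk : r \oc k = idm T by apply: km; rewrite ccompA kr ek compm1.
have kj j : k \oc (r \oc inj (phi j)) = inj (phi j) by rewrite ccompA kr ej.
exists T, (fun j => r \oc inj (phi j)); apply: is_coproductP => [W x y xy|W g].
  rewrite -[x]compm1 -[y]compm1 -rk !ccompA; congr (_ \oc _).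
  apply: (coproduct_joint_epi co) => i; rewrite -!ccompA.
  have [[j <-]|N] := pselect (exists j, phi j = i); first exact: xy.
  have -> : r \oc inj i = 0 by apply: km; rewrite ccompA kr e0 // compm0.
  by rewrite !compm0.
have [h [hj _]] := extend W g.
by exists (h \oc k) => j; rewrite -ccompA kj hj.
Qed.

Lemma has_copower_ord (C : abelianCat) (V : C) (n : nat) : has_copower V 'I_n.
Proof.
elim: n => [|n IHn].
  have [Z Z0] := ab_zero (ab_axioms C).
  exists Z, (fun i : 'I_0 => False_rect _ (notF (ltn_ord i))).
  apply: is_coproductP => [W x y _|W f].
    by rewrite ((Z0 W).2 x) ((Z0 W).2 y).
  by exists 0 => -[].
have : has_copower V (unit + 'I_n).
  by apply: has_copower_sum IHn; exists V; exact: copower_unit.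
apply: has_copower_injects.
exists (fun i => if unlift ord0 i is Some j then inr j else inl tt) => i j.
by case: unliftP => [i' ->|->]; case: unliftP => [j' ->|->] // [->].
Qed.

Lemma card_le_injects (X Y : Type) (B : set Y) : ([set: X] #<= B)%card ->
  exists f : X -> Y, injective f /\ forall x, B (f x).
Proof.
move=> /card_leP[f]; exists (fun x => val (f (to_setT x))).
split=> [x y /val_inj /inj|x]; last exact: set_valP.
by rewrite !inE => /(_ I I) /(congr1 val).
Qed.

Lemma injects_nat_or_ord (K : Type) : injects nat K \/ exists n, injects K 'I_n.
Proof.
have [[n]|/infiniteP/card_le_injects[f [fI _]]] := pselect (finite_set [set: K]);
  last by left; exists f.
move=> /card_eqPle[/card_le_injects[f [fI fn]] _]; right; exists n.
by exists (fun x => Ordinal (fn x)) => x y /(congr1 val) /fI.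
Qed.

(** [I * J] injects into the square of [K = I + J]. An infinite [K] absorbs its square; for a finite
    one the copower is finite and exists by biproducts. *)
Lemma has_copower_prod (C : abelianCat) (V : C) (I J : Type) :
  has_copower V I -> has_copower V J -> has_copower V (I * J).
Proof.
move=> cI cJ; pose K : Type := (I + J)%type.
have cK : has_copower V K by exact: has_copower_sum.
have IJ : injects (I * J) (K * K).
  by exists (fun p => (inl p.1, inr p.2)) => -[i j] [i' j'] /= [-> ->].
have [natK|[n [f fI]]] := injects_nat_or_ord K.
  by apply: has_copower_injects cK; exact: injects_trans IJ (injects_square natK).
apply: has_copower_injects (has_copower_ord V #|{: 'I_n * 'I_n}|).
apply: (injects_trans IJ); exists (fun p => enum_rank (f p.1, f p.2)).
by move=> [x y] [x' y'] /enum_rank_inj /= [/fI -> /fI ->].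
Qed.

Lemma copower_of_copower (C : abelianCat) (V S N : C) (I J : Type) :
  is_copower V J S -> is_copower V (J * I) N -> is_copower S I N.
Proof.
move=> [s cs] [n cn].
pose t i := cid (coproduct_desc cs (fun j => n (j, i))).
exists (fun i => projT1 (t i)); apply: is_coproductP => [W x y xy|W f].
  apply: (coproduct_joint_epi cn) => -[j i].
  by rewrite -(projT2 (t i)) !ccompA xy.
have [h hf] := coproduct_desc cn (fun p => f p.2 \oc s p.1).
exists h => i; apply: (coproduct_joint_epi cs) => j.
by rewrite -ccompA (projT2 (t i)) hf.
Qed.

(** Coproducts commute with cokernels; this is what produces a copower of an object presented by [A]
    and [B]. *)
Lemma copower_cokernel (C : abelianCat) (A B Q SA SB SQ : C) (I : Type)
    (a : I -> mor A SA) (b : I -> mor B SB) (f : mor A B) (q : mor B Q)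
    (F : mor SA SB) (c : mor SB SQ) :
  is_coproduct (X := fun=> A) a -> is_coproduct (X := fun=> B) b ->
  (forall i, F \oc a i = b i \oc f) -> is_cokernel f q -> is_cokernel F c ->
  is_copower Q I SQ.
Proof.
move=> ca cb Fab fq Fc.
have d i : exists d : mor Q SQ, d \oc q = c \oc b i.
  apply: (cokernel_desc fq).
  by rewrite -ccompA -Fab ccompA Fc.1 comp0m.
pose n i := projT1 (cid (d i)).
have nq i : n i \oc q = c \oc b i := projT2 (cid (d i)).
have qe := cokernel_epi fq; have ce := cokernel_epi Fc.
exists n; apply: is_coproductP => [W x y xy|W g].
  apply: ce; apply: (coproduct_joint_epi cb) => i.
  by rewrite -!ccompA -nq !ccompA xy.
have [h hg] := coproduct_desc cb (fun i => g i \oc q).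
have [|w wc] := cokernel_desc Fc (g := h).
  apply: (coproduct_joint_epi ca) => i.
  by rewrite -ccompA Fab ccompA hg -ccompA fq.1 compm0 comp0m.
by exists w => i; apply: qe; rewrite -ccompA nq ccompA wc hg.
Qed.

Lemma has_copower_transfer (C : abelianCat) (G V : C) (I : Type) :
  epi_generator G -> has_copower G I -> has_copower V I.
Proof.
move=> hG cI; have [S [s [[J cJ] se]]] := hG V.
have [K [k ks]] := epi_ses se; have [S' [s' [[J' cJ'] s'e]]] := hG K.
(* [V] is presented by the copowers [S'] and [S] of [G], indexed by [J'] and [J]. *)
have coker : is_cokernel (k \oc s') s := cokernel_comp_epi s'e ks.2.
have [N cN] : has_copower G (J * I) by apply: has_copower_prod => //; exists S.
have [M cM] : has_copower G (J' * I) by apply: has_copower_prod => //; exists S'.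
have [n cn] := copower_of_copower cJ cN; have [m cm] := copower_of_copower cJ' cM.
have [F Fmn] := coproduct_desc cm (fun i => n i \oc (k \oc s')).
have [Q [c Fc]] := ab_cokernel (ab_axioms C) F.
by exists Q; exact: copower_cokernel cm cn Fmn coker Fc.
Qed.

(** Where a copower of [G] exists, so does one of [G'], by [has_copower_transfer], and it maps onto
    the former along [pi]. *)
Lemma epi_generator_quotient (C : abelianCat) (G G' : C) (pi : mor G' G) :
  epi_generator G -> epi pi -> epi_generator G'.
Proof.
move=> hG pie A; have [S [s [[I [a ca]] se]]] := hG A.
have [|S' [b cb]] := @has_copower_transfer C G G' I hG; first by exists S, a.
have [h hab] := coproduct_desc cb (fun i => a i \oc pi).
exists S', (s \oc h); split; first by exists I, b.
apply: epi_comp => // W x y xy; apply: (coproduct_joint_epi ca) => i.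
by apply: pie; rewrite -!ccompA -hab !ccompA xy.
Qed.

(** * Torsion pairs and Ext-orthogonality *)

(** Every retract has a complement, the kernel of the retraction, so [i] and [p] alone describe a
    summand. *)
Lemma AddP (C : abelianCat) (V X : C) :
  Add V X <-> exists S (i : mor X S) (p : mor S X), copowers V S /\ p \oc i = idm X.
Proof.
split=> [[S [B [i [j [p [q [cS bip]]]]]]]|[S [i [p [cS pi]]]]].
  by exists S, i, p; split=> //; exact: biprod_pi bip.
have [B [j [q bip]]] := retraction_biproduct pi.
by exists S, B, i, j, p, q.
Qed.

Lemma copowers_Add (C : abelianCat) (V S : C) : copowers V S -> Add V S.
Proof. by move=> cS; apply/AddP; exists S, (idm S), (idm S); rewrite comp1m. Qed.

Lemma Add_retract (C : abelianCat) (V X S : C) (i : mor X S) (p : mor S X) :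
  p \oc i = idm X -> Add V S -> Add V X.
Proof.
move=> pi /AddP[S' [i' [p' [cS pi']]]]; apply/AddP.
exists S', (i' \oc i), (p \oc p'); split=> //.
by rewrite -ccompA [p' \oc _]ccompA pi' comp1m.
Qed.

Lemma Add_biproduct (C : abelianCat) (V A B S : C)
    (i : mor A S) (j : mor B S) (p : mor S A) (q : mor S B) :
  is_biproduct i j p q -> Add V A -> Add V B -> Add V S.
Proof.
move=> bip /AddP[SA [iA [pA [[I cA] piA]]]] /AddP[SB [iB [pB [[J cB] piB]]]].
have [S' [i' [j' [p' [q' bip']]]]] := ab_biprod (ab_axioms C) SA SB.
have cS : copowers V S' by exists (I + J)%type; exact: copower_sum bip' cA cB.
apply: (@Add_retract _ _ _ _ (i' \oc (iA \oc p) + j' \oc (iB \oc q))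
  (i \oc (pA \oc p') + j \oc (pB \oc q')) _ (copowers_Add cS)).
have [E1 E2] := biproduct_pair bip' (iA \oc p) (iB \oc q).
rewrite compDl -!ccompA E1 E2 [pA \oc _]ccompA [pB \oc _]ccompA piA piB !comp1m.
exact: biprod_sum bip.
Qed.

Lemma Add_copower_retract (C : abelianCat) (V W S : C) (I : Type)
    (i : mor W V) (p : mor V W) :
  p \oc i = idm W -> has_copower V I -> is_copower W I S -> Add V S.
Proof.
move=> pi [S' [b cb]] [a ca].
have [h hE] := coproduct_desc ca (fun x => b x \oc i).
have [r rE] := coproduct_desc cb (fun x => a x \oc p).
apply: (@Add_retract _ _ _ _ h r); last by apply: copowers_Add; exists I, b.
apply: (coproduct_joint_epi ca) => x.
by rewrite -ccompA hE ccompA rE -ccompA pi compm1 comp1m.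
Qed.

Lemma lperp1_Add (C : abelianCat) (T : set C) (V X : C) :
  lperp1 T V -> Add V X -> lperp1 T X.
Proof.
move=> TV /AddP[S [i [p [[I [a ca]] pi]]]] Y TY; apply: Ext1_retract pi _.
by apply: Ext1_coproduct ca _ => _; exact: TV.
Qed.

Lemma lperp1_middle (C : abelianCat) (T : set C) (A E X : C) (f : mor A E)
    (g : mor E X) :
  short_exact f g -> lperp1 T A -> lperp1 T X -> lperp1 T E.
Proof. by move=> fg TA TX Y TY; apply: Ext1_middle fg _ _; [exact: TA|exact: TX]. Qed.

Lemma rperp1_lperp1 (C : abelianCat) (T : set C) : T `<=` rperp1 (lperp1 T).
Proof. by move=> Y TY X; apply. Qed.

Section Torsion.
Variables (C : abelianCat) (T F : set C).
Hypothesis tTF : torsion_pair T F.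

Lemma torsionE A : T A <-> forall Y, F Y -> forall f : mor A Y, f = 0.
Proof. by have [_ -> _] := tTF. Qed.

Lemma torsion_quotient A B (f : mor A B) : epi f -> T A -> T B.
Proof.
move=> fe /torsionE TA; apply/torsionE => Y FY g.
by apply: ((epi0P f).1 fe); exact: TA.
Qed.

Lemma torsion_retract A B (i : mor A B) (p : mor B A) : p \oc i = idm A -> T B -> T A.
Proof. by move=> /epi_of_section; exact: torsion_quotient. Qed.

Lemma torsion_middle A E X (f : mor A E) (g : mor E X) :
  short_exact f g -> T A -> T X -> T E.
Proof.
move=> fg /torsionE TA /torsionE TX; apply/torsionE => Y FY u.
have [v <-] := cokernel_desc fg.2 (TA Y FY (u \oc f)).
by rewrite (TX Y FY v) comp0m.
Qed.

Lemma torsion_coproduct I (X : I -> C) S (inj : forall i, mor (X i) S) :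
  is_coproduct inj -> (forall i, T (X i)) -> T S.
Proof.
move=> co TX; apply/torsionE => Y FY u; apply: (coproduct_joint_epi co) => i.
by rewrite comp0m; exact: (torsionE _).1 (TX i) Y FY _.
Qed.

Lemma Add_torsion V : T V -> Add V `<=` T.
Proof.
move=> TV X /AddP[S [i [p [[I [a ca]] pi]]]]; apply: torsion_retract pi _.
exact: torsion_coproduct ca _.
Qed.

Lemma Gen_torsion V : T V -> Gen V `<=` T.
Proof.
by move=> TV X [N [f [/(Add_torsion TV) TN fe]]]; exact: torsion_quotient fe TN.
Qed.

Hypothesis coT : cogenerating T.

(* For an extension [E] of [X] by [Y] in [T], embed [E] into [TE] in [T]: the
   induced map [X -> TE/Y] extends to [B], since [Ext1 D (TE/Y) = 0], and then
   lifts to [B -> TE], since [Ext1 B Y = 0]; on [X] this lift lands in [E]. *)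
Lemma lperp1_kernel (X B D : C) (x : mor X B) (d : mor B D) :
  short_exact x d -> lperp1 T B -> lperp1 T D -> lperp1 T X.
Proof.
move=> xd TB TD Y TY; apply/Ext1_eq0P => E f g fg.
have [TE [m [TTE mm]]] := coT E.
have [D' [c mfc]] := mono_ses (mono_comp mm (ses_mono fg)).
have TD' : T D' by apply: torsion_quotient TTE; exact: ses_epi mfc.
have [|u uE] := cokernel_desc fg.2 (g := c \oc m).
  by rewrite -ccompA (ses_comp0 mfc).
have [v vx] := Ext1_extend (TD _ TD') xd u.
have [w cw] := Ext1_lift (TB _ TY) mfc v.
have [Q [n mn]] := mono_ses mm.
have [|n' n'c] := cokernel_desc mfc.2 (g := n).
  by rewrite ccompA (ses_comp0 mn) comp0m.
have n'u : n' \oc u = 0.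
  by apply: (ses_epi fg); rewrite -ccompA uE ccompA n'c (ses_comp0 mn) comp0m.
have [|s ms] := kernel_lift mn.1 (g := w \oc x).
  by rewrite -n'c ccompA -[n' \oc c \oc w]ccompA cw -ccompA vx.
have cms : c \oc m \oc s = u by rewrite -ccompA ms ccompA cw.
(* [s \oc g] and the identity of [E] agree after [c \oc m], so they differ by a map through [f],
   which [g] kills. *)
have [|t tE] := kernel_lift mfc.1 (g := m \oc (s \oc g - idm E)).
  by rewrite !compBr compm1 !ccompA cms uE subrr.
have ft : f \oc t = s \oc g - idm E by apply: mm; rewrite ccompA.
exists s; apply: (ses_epi fg); rewrite comp1m -ccompA; apply/eqP.
by rewrite -subr_eq0 -[X in _ - X]compm1 -compBr -ft ccompA (ses_comp0 fg) comp0m.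
Qed.

End Torsion.

(** * Tilting objects *)

Section TiltingObject.
Variables (C : abelianCat) (T F : set C) (V : C).
Hypotheses (tTF : torsion_pair T F) (tV : tilting_via V T).

(** As [T] cogenerates, [subGen V] contains every object, and only the orthogonality condition
    remains. *)
Lemma tilting_rperp1 : T = rperp1 [set V].
Proof.
have [TG GP PS co] := tV; rewrite {1}TG GP PS; apply/seteqP; split=> [Y []//|Y VY].
by split=> //; rewrite /subGen -TG; exact: co.
Qed.

Lemma tilting_lperp1 : lperp1 T V.
Proof. by move=> Y; rewrite tilting_rperp1 => /(_ V erefl). Qed.

Lemma tilting_Add_torsion : Add V `<=` T.
Proof.
apply: (Add_torsion tTF); have [-> _ _ _] := tV.
exists V, (idm V); split; last by move=> W g h; rewrite !compm1.
by apply: copowers_Add; exists unit; exact: copower_unit.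
Qed.

(** In a presentation of [Y] by [Add V], the kernel of [N -> Y] is a quotient of the first term,
    hence lies in [Gen V]. *)
Lemma tilting_presentation Y : T Y ->
  exists K N (k : mor K N) (n : mor N Y), [/\ short_exact k n, T K & Add V N].
Proof.
have [TG GP _ _] := tV; rewrite {1}TG GP => -[M [N [f [g [aM aN fg]]]]].
have [K [k kg]] := epi_ses (cokernel_epi fg).
have [f' f'e _] := cokernel_kernel_epi fg kg.1.
exists K, N, k, g; split=> //.
by rewrite TG; exists M, f'.
Qed.

(** Embed [A] into [T0] in [T], with cokernel [D], and present [D] by [N] in [Add V] with kernel in
    [T]. The pullback of [N] and [T0] over [D] is an extension of [T0] by that kernel, and contains
    [A] with cokernel [N]. *)
Lemma tilting_coresolution A :
  exists Y N (f : mor A Y) (g : mor Y N), [/\ short_exact f g, T Y & Add V N].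
Proof.
have [_ _ _ co] := tV; have [T0 [a [TT0 am]]] := co A.
have [D [b ab]] := mono_ses am.
have TD : T D := torsion_quotient tTF (ses_epi ab) TT0.
have [K [N [k [n [kn TK aN]]]]] := tilting_presentation TD.
have [P [p [q [k' [m' [k'q m'p _ _ _]]]]]] := pullback_epi_ses kn ab.
exists P, N, m', p; split=> //.
exact: (torsion_middle tTF k'q TK TT0).
Qed.

Lemma tilting_right_complete_cotorsion_pair : right_complete_cotorsion_pair (lperp1 T) T.
Proof.
split; first (split=> //; apply/seteqP; split).
- exact: rperp1_lperp1.
- by move=> Y /(_ _ tilting_lperp1) YV; rewrite tilting_rperp1 => _ ->.
- move=> A; have [Y [N [f [g [fg TY aN]]]]] := tilting_coresolution A.
  by exists Y, N, f, g; split=> //; exact: lperp1_Add tilting_lperp1 aN.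
Qed.

(** Coresolve [G] by [Y] in [T] and [N] in [Add V], and cover [Y] by [N0] in [Add V]. The pullback
    [G'] of [G] and [N0] maps onto [G] and is the kernel of an epimorphism [N0 -> N], so
    [lperp1_kernel] applies to it. *)
Lemma tilting_epi_generator (G : C) : epi_generator G ->
  exists2 G' : C, lperp1 T G' & epi_generator G'.
Proof.
move=> hG; have [Y [N [f [g [fg TY aN]]]]] := tilting_coresolution G.
have [K [N0 [k [n [kn TK aN0]]]]] := tilting_presentation TY.
have [G' [k' [n' [a' [k'n' a'N _ _]]]]] := pullback_mono_ses kn fg.
have [_ _ _ co] := tV; exists G'.
  by apply: (lperp1_kernel tTF co a'N); exact: lperp1_Add tilting_lperp1 _.
exact: epi_generator_quotient hG (ses_epi k'n').
Qed.

(** For [X] on the right, the presentation with kernel in [T] splits. Consequently [Add V] can be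
    recovered from [T]. *)
Lemma tilting_Add : Add V = T `&` lperp1 T.
Proof.
apply/seteqP; split=> [X aX|X [TX lX]].
  by split; [exact: tilting_Add_torsion|exact: lperp1_Add tilting_lperp1 aX].
have [K [N [k [n [kn TK aN]]]]] := tilting_presentation TX.
have [s ns] := Ext1_section (lX _ TK) kn.
exact: Add_retract ns aN.
Qed.

End TiltingObject.

(** * Completeness and special preenvelopes *)

Lemma right_complete_left_complete (C : abelianCat) (T : set C) (G : C) :
  right_complete (lperp1 T) T -> lperp1 T G -> epi_generator G ->
  left_complete (lperp1 T) T.
Proof.
(* Salce's argument: cover [A] by a copower of [G] and push out along an embedding of the kernel
   into an object of [T]. *)
move=> rc lG hG A; have [S [s [[I [a ca]] se]]] := hG A.
have [K [k ks]] := epi_ses se; have [Y [X [f [g [TY lX fg]]]]] := rc K.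
have [P [p [q [k' [m' [qk pm _ _ _]]]]]] := pushout_mono_ses ks fg.
exists Y, P, q, k'; split=> //.
apply: lperp1_middle pm _ lX => Z TZ; apply: Ext1_coproduct ca _ => _; exact: lG.
Qed.

Lemma complete_preenveloping (C : abelianCat) (T : set C) :
  complete_cotorsion_pair (lperp1 T) T ->
  special_preenveloping T /\ generates (lperp1 T) T.
Proof.
move=> [_ lc rc]; split=> [M|A _].
  have [Y [X [f [g [TY lX fg]]]]] := rc M; exists Y, f; split=> //.
  - exact: ses_mono fg.
  - by move=> Z TZ u; exact: Ext1_extend (lX _ TZ) fg u.
  - by exists X, g; split=> //; exact: fg.2.
by have [Y [X [f [g [TY lX fg]]]]] := lc A; exists X, g; split=> //; exact: ses_epi fg.
Qed.

Lemma preenveloping_right_complete (C : abelianCat) (T : set C) :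
  special_preenveloping T -> right_complete (lperp1 T) T.
Proof.
move=> sp A; have [TA [f [fm TTA _ [Q [q [fq lQ]]]]]] := sp A.
by exists TA, Q, f, q; split=> //; split=> //; exact: mono_kernel.
Qed.

Lemma right_complete_cogenerating (C : abelianCat) (T : set C) :
  right_complete (lperp1 T) T -> cogenerating T.
Proof.
by move=> rc A; have [Y [X [f [g [TY _ /ses_mono fm]]]]] := rc A; exists Y, f.
Qed.

(** Covers are available for objects of [T] only, so [A] is first embedded into [TA]. Salce's
    pushout turns a cover of [TA] into one by [P] with kernel in [T]; its pullback to [A] is the
    kernel of [P -> Q], to which [lperp1_kernel] applies. *)
Lemma preenveloping_complete (C : abelianCat) (T F : set C) :
  torsion_pair T F -> special_preenveloping T -> generates (lperp1 T) T ->
  complete_cotorsion_pair (lperp1 T) T.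
Proof.
move=> tTF /preenveloping_right_complete rc gen.
have co := right_complete_cogenerating rc.
split=> //.
  split=> //; apply/seteqP; split=> [|Y TY]; first exact: rperp1_lperp1.
  have [TA [X [f [g [TTA lX fg]]]]] := rc Y.
  have [r rf] := Ext1_retraction (TY _ lX) fg.
  exact: (torsion_retract tTF) rf TTA.
move=> A; have [TA [Q [f [g [TTA lQ fg]]]]] := rc A.
have [X [x [lX xe]]] := gen _ TTA.
have [K [k kx]] := epi_ses xe; have [TK [Q' [f' [g' [TTK lQ' fg']]]]] := rc K.
have [P [p [q [k' [m' [qk pm _ _ _]]]]]] := pushout_mono_ses kx fg'.
have [P' [k'' [n' [a' [kn an _ _]]]]] := pullback_mono_ses qk fg.
exists TK, P', k'', n'; split=> //.
exact: (lperp1_kernel tTF co an (lperp1_middle pm lX lQ') lQ).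
Qed.

(* Coproducts are only right exact; the left map is a monomorphism because an
   embedding of [H] into an object of [T] factors through it. *)
Lemma copower_ses (C : abelianCat) (T : set C) (G V0 V1 H : C) (I : Type)
    (u : mor G V0) (v : mor V0 V1) :
  cogenerating T -> short_exact u v -> lperp1 T V1 ->
  is_copower G I H -> has_copower V0 I ->
  exists S0 S1 (f : mor H S0) (g : mor S0 S1),
    [/\ short_exact f g, is_copower V0 I S0 & is_copower V1 I S1].
Proof.
move=> co uv lV1 [a ca] [S0 [b cb]].
have [f fE] := coproduct_desc ca (fun i => b i \oc u).
have [S1 [g fg]] := ab_cokernel (ab_axioms C) f.
exists S0, S1, f, g; split; last first.
- exact: copower_cokernel ca cb fE uv.2 fg.
- by exists b.
split=> //; apply: mono_kernel fg.
have [Y [m [TY mm]]] := co H.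
pose ext i := cid (Ext1_extend (lV1 _ TY) uv (m \oc a i)).
have [h hE] := coproduct_desc cb (fun i => projT1 (ext i)).
have hf : h \oc f = m.
  apply: (coproduct_joint_epi ca) => i.
  by rewrite -ccompA fE ccompA hE (projT2 (ext i)).
by apply: (@mono_of_comp _ _ _ _ h); rewrite hf.
Qed.

(** * The tilting object [V0 (+) V1] of a complete cotorsion pair *)

Section CompleteCotorsion.
Variables (C : abelianCat) (T F : set C) (G V0 V1 V : C).
Variables (u : mor G V0) (v : mor V0 V1).
Variables (i0 : mor V0 V) (i1 : mor V1 V) (p0 : mor V V0) (p1 : mor V V1).
Hypotheses (tTF : torsion_pair T F) (cc : complete_cotorsion_pair (lperp1 T) T).
Hypotheses (hG : epi_generator G) (lG : lperp1 T G).
Hypotheses (uv : short_exact u v) (TV0 : T V0) (lV1 : lperp1 T V1).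
Hypothesis bip : is_biproduct i0 i1 p0 p1.

Let co : cogenerating T. Proof. by have [_ _ /right_complete_cogenerating] := cc. Qed.
Let lV0 : lperp1 T V0. Proof. exact: lperp1_middle uv lG lV1. Qed.
Let TV1 : T V1. Proof. exact: (torsion_quotient tTF) (ses_epi uv) TV0. Qed.

(** Cover [A] by a copower [H] of [G] and take copowers of [uv] with the same index; those of [V0]
    and [V1] are retracts of that of [V]. *)
Lemma generator_coresolution A :
  exists H S0 S1 (h : mor H A) (f : mor H S0) (g : mor S0 S1),
  [/\ epi h, short_exact f g, T S0, lperp1 T S1 & Add V S0 /\ Add V S1].
Proof.
have [H [h [[I cH] he]]] := hG A.
have cop X : has_copower X I := has_copower_transfer X hG (ex_intro _ H cH).
have [S0 [S1 [f [g [fg cS0 cS1]]]]] := copower_ses co uv lV1 cH (cop V0).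
have pi0 := biprod_pi bip; have pi1 := biprod_qj bip.
exists H, S0, S1, h, f, g; split=> //.
- by case: cS0 => b cb; exact: (torsion_coproduct tTF cb).
- by apply: lperp1_Add lV1 _; apply: copowers_Add; exists I.
- by split; [apply: Add_copower_retract pi0 _ cS0|apply: Add_copower_retract pi1 _ cS1].
Qed.

(** Push [H -> S0] out along [H -> A]: the cokernel [S1] is unchanged, and the pushout is in [T] as
    a quotient of [S0]. *)
Lemma torsion_Add_coresolution A : exists Z N (f : mor A Z) (g : mor Z N),
  [/\ short_exact f g, T Z, lperp1 T N & Add V N].
Proof.
have [H [S0 [S1 [h [f [g [he fg TS0 lS1 [_ aS1]]]]]]]] := generator_coresolution A.
have [L [l lh]] := epi_ses he.
have [Z [g' [f' [z [f'g' lz _ _]]]]] := pushout_epi_ses fg lh.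
by exists Z, S1, f', g'; split=> //; exact: (torsion_quotient tTF (ses_epi lz)).
Qed.

(* For [H -> X] epi with kernel [L], the pushouts [P] of [H] and [Z] along [L],
   then [W] of [P] and [S0] along [H], give [W = P (+) S1 = S0 (+) N], and [X] is
   a summand of [P]. *)
Lemma torsion_lperp1_Add : T `&` lperp1 T `<=` Add V.
Proof.
move=> X [TX lX].
have [H [S0 [S1 [h [f [g [he fg TS0 lS1 [aS0 aS1]]]]]]]] := generator_coresolution X.
have [L [l lh]] := epi_ses he.
have [Z [N [z [n [zn TZ lN aN]]]]] := torsion_Add_coresolution L.
have [P [p [q [x [m [qx pm _ _ _]]]]]] := pushout_mono_ses lh zn.
have [s xs] := Ext1_section (lX _ TZ) qx.
have TP : T P by exact: (torsion_middle tTF qx).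
have [W [a [b [c [d [bc ad _ _ _]]]]]] := pushout_mono_ses pm fg.
(* Both sequences through [W] split: [P] and [S0] lie in [T], while the cokernels [S1] and [N] lie
   in [lperp1 T]. *)
have [r ra] := Ext1_retraction (lS1 _ TP) ad.
have [r' r'b] := Ext1_retraction (lN _ TS0) bc.
have [t _ bipW] := ses_section bc r'b.
have aW : Add V W by exact: Add_biproduct bipW aS0 aN.
apply: (@Add_retract _ _ _ _ (a \oc s) (x \oc r) _ aW).
by rewrite -ccompA [r \oc _]ccompA ra comp1m.
Qed.

Lemma complete_tilting_via : tilting_via V T.
Proof.
have [_ lc _] := cc; have ip := biproduct_ses bip.
have lV : lperp1 T V := lperp1_middle ip lV0 lV1.
have TV : T V := torsion_middle tTF ip TV0 TV1.
(* The cover [X] of [Y] is an extension of [Y] by an object of [T], so it lies in both [T] and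
   [lperp1 T], that is, in [Add V]. *)
have pres Y : T Y -> exists K X (k : mor K X) (x : mor X Y),
    [/\ short_exact k x, T K & Add V X].
  move=> TY; have [K [X [k [x [TK lX kx]]]]] := lc Y; exists K, X, k, x; split=> //.
  by apply: torsion_lperp1_Add; split=> //; exact: (torsion_middle tTF kx).
have TG : T = Gen V.
  apply/seteqP; split=> [Y /pres[K [X [k [x [kx _ aX]]]]]|];
    last exact: (Gen_torsion tTF).
  by exists X, x; split=> //; exact: ses_epi kx.
have GP : Gen V = Pres V.
  apply/seteqP; split=> [Y|Y [M [N [f [g [_ aN /cokernel_epi ge]]]]]];
    last by exists N, g.
  rewrite -TG => /pres[K [X [k [x [kx TK aX]]]]].
  have [K' [X' [k' [x' [kx' _ aX']]]]] := pres _ TK.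
  exists X', X, (k \oc x'), x; split=> //.
  by apply: cokernel_comp_epi kx.2; exact: ses_epi kx'.
split=> //; rewrite -GP -TG; apply/seteqP; split=> [Y TY|Y [_ VY]].
  split; last by move=> _ ->; exact: lV.
  by exists Y, (idm Y); rewrite -TG; split=> // W x y; rewrite !comp1m.
(* Orthogonality to [V] passes to [N] in [Add V], so [Y] is a retract of [Z] in [T]. *)
have [Z [N [f [g [fg TZ _ aN]]]]] := torsion_Add_coresolution Y.
have lN : lperp1 [set Y] N.
  by apply: lperp1_Add aN => _ ->; exact: VY.
have [r rf] := Ext1_retraction (lN _ erefl) fg.
exact: (torsion_retract tTF rf).
Qed.

End CompleteCotorsion.

(** * The equivalences and the bijection *)

Lemma preenveloping_tilting (C : abelianCat) (T F : set C) :
  (exists G : C, epi_generator G) -> torsion_pair T F ->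
  special_preenveloping T -> generates (lperp1 T) T -> tilting_torsion_pair T F.
Proof.
move=> [G0 hG0] tTF sp gen; have cc := preenveloping_complete tTF sp gen.
split=> //; have [_ lc rc] := cc.
(* Left completeness covers the given epi-generator by an object of [lperp1 T], which is again an
   epi-generator. *)
have [Y [G [y [pi [_ lG ypi]]]]] := lc G0.
have hG := epi_generator_quotient hG0 (ses_epi ypi).
have [V0 [V1 [u [v [TV0 lV1 uv]]]]] := rc G.
have [V [i0 [i1 [p0 [p1 bip]]]]] := ab_biprod (ab_axioms C) V0 V1.
by exists V; exact: complete_tilting_via tTF cc hG lG uv TV0 lV1 bip.
Qed.

Lemma tilting_preenveloping (C : abelianCat) (T F : set C) (V G : C) :
  epi_generator G -> torsion_pair T F -> tilting_via V T ->
  special_preenveloping T /\ generates (lperp1 T) T.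
Proof.
move=> hG tTF tV; apply: complete_preenveloping.
have [cp rc] := tilting_right_complete_cotorsion_pair tTF tV; split=> //.
have [G' lG' hG'] := tilting_epi_generator tTF tV hG.
exact: right_complete_left_complete rc lG' hG'.
Qed.

Theorem corollary5p12 (C : abelianCat)
    (hG : exists G : C, epi_generator G) :
  (forall T F : set C, torsion_pair T F ->
    [<-> tilting_torsion_pair T F;
         right_complete_cotorsion_pair (lperp1 T) T /\
           (exists2 G : C, lperp1 T G & epi_generator G);
         complete_cotorsion_pair (lperp1 T) T;
         special_preenveloping T /\ generates (lperp1 T) T]) /\
  (exists Phi : set C -> set C,
    (forall V : C, tilting_object V -> Phi (tilting_eqclass V) = Gen V) /\
    set_bij (@tilting_eqclasses C)
      [set T : set C | [/\ torsion_class T, special_preenveloping T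
                         & generates (lperp1 T) T]]%classic
      Phi).
Proof.
have [G hG0] := hG; split=> [T F tTF|].
  tfae.
  - move=> [_ [V tV]]; split; first exact: tilting_right_complete_cotorsion_pair tTF tV.
    exact: tilting_epi_generator tTF tV G hG0.
  - move=> [[cp rc] [G' lG' hG']]; split=> //.
    exact: right_complete_left_complete rc lG' hG'.
  - exact: complete_preenveloping.
  - by move=> [sp gen]; exact: preenveloping_tilting.
have cls V : tilting_object V -> tilting_eqclass V V by [].
(* A union over all members makes [Phi] total on sets of objects; on an equivalence class it is a
   single [Gen V], since [Gen V] depends only on [Add V]. *)
pose Phi (c : set C) : set C := [set A | exists2 V, c V & Gen V A].
have PhiE V : tilting_object V -> Phi (tilting_eqclass V) = Gen V.
  move=> tV; apply/seteqP; split=> [A [W [_ VW]]|A VA]; last by exists V.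
  by rewrite /Gen VW.
exists Phi; split=> //; split.
- move=> _ [V tV ->]; rewrite PhiE //; have [T [F [tTF tVT]]] := tV.
  have [TG _ _ _] := tVT; have [sp gen] := tilting_preenveloping hG0 tTF tVT.
  by rewrite -TG; split=> //; exists F.
- move=> c d /set_mem[V tV ->] /set_mem[W tW ->]; rewrite !PhiE // => VW.
  have [T [F [tTF tVT]]] := tV; have [T' [F' [tTF' tWT']]] := tW.
  (* Equal values of [Gen] mean equal torsion classes, from which [tilting_Add] recovers
     [Add V = Add W]. *)
  have TT' : T = T' by have [-> _ _ _] := tVT; have [-> _ _ _] := tWT'.
  rewrite /tilting_eqclass (tilting_Add tTF tVT) (tilting_Add tTF' tWT').
  by rewrite TT'.
- move=> T [[F tTF] sp gen]; have [_ [V tV]] := preenveloping_tilting hG tTF sp gen.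
  have toV : tilting_object V by exists T, F.
  exists (tilting_eqclass V); first by exists V.
  by rewrite PhiE //; have [-> _ _ _] := tV.
Qed.
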